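(* Let $S$ be a set of $n\ge 2$ agents in a communication network and let $H=(S,F)$, $F=\{E_1,\dots,E_m\}$, be their entangled hypergraph. A pure $n$-partite maximally entangled state can be prepared amongst the $n$ agents (one qubit held by each agent) by local operations and classical communication if and only if $H$ is connected.
   Context: A pure $k$-partite maximally entangled state is a $k$-qubit state, one qubit per agent, obtained from $(|00\cdots0\rangle+|11\cdots1\rangle)/\sqrt{2}$ by applying single-qubit unitaries to the individual qubits. The entangled hypergraph of the agents is $H=(S,F)$ with hyperedges $F=\{E_1,\dots,E_m\}$, where the $E_i\subseteq S$ (with $|E_i|\ge 2$, possibly of different sizes) are the subsets of agents such that the $|E_i|$ agents in $E_i$ share a pure $|E_i|$-partite maximally entangled state. The initial joint state is the tensor product over the hyperedges of these shared states (an agent holds one qubit for each hyperedge containing it), together with local ancilla qubits in state $|0\rangle$; there is no other initial entanglement. A hyperpath from a vertex $a\in S$ to a vertex $b\in S$ is a sequence of hyperedges $E_1,\dots,E_j$ (relabelled) such that $E_i$ and $E_{i+1}$ have a common vertex for all $1\le i\le j-1$, $a\in E_1$, and $b\in E_j$. $H$ is connected if there is a hyperpath between every pair of vertices of $S$. Local operations and classical communication (LOCC): each agent may adjoin ancillas, apply unitaries and perform measurements on the qubits it holds, conditioned on earlier outcomes and on received classical bits, and agents may exchange classical bits. There is no quantum communication. A state is ''prepared'' if, for every sequence of measurement outcomes, at the end $n$ designated qubits, one per agent, are in that state (up to global phase, in tensor product with the remaining qubits). *)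

(* Defs.v *)
From mathcomp Require Import all_boot all_order all_algebra.
From mathcomp Require Import sesquilinear spectral.
From mathcomp Require Import reals.
From mathcomp Require Import complex.

Set Implicit Arguments.
Unset Strict Implicit.
Unset Printing Implicit Defensive.

Import Order.TTheory GRing.Theory Num.Theory.
Local Open Scope ring_scope.
Local Open Scope sesquilinear_scope.

(** * Registers of qubits

    The qubits of a register are labelled by the elements of a finite type [Q].
    A pure state is given by its amplitudes in the computational basis, so that
    (C^2)^{(x) Q} is rendered as [state C Q]. *)

Definition bits (Q : finType) := {ffun Q -> 'I_2}.

Definition state (C : numClosedFieldType) (Q : finType) := {ffun bits Q -> C}.

Definition normalize (C : numClosedFieldType) (Q : finType)
    (psi : state C Q) : state C Q :=
  [ffun x => (sqrtC (\sum_y `|psi y| ^+ 2))^-1 * psi x].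

(* (|00...0> + |11...1>) / sqrt 2 *)
Definition ghz (C : numClosedFieldType) (Q : finType) : state C Q :=
  [ffun x : bits Q =>
    (sqrtC 2)^-1 * ((x == [ffun=> ord0])%:R + (x == [ffun=> ord_max])%:R)].

(* The operator \bigotimes_q U q, where U q acts on the qubit q. *)
Definition tensor_apply (C : numClosedFieldType) (Q : finType)
    (U : Q -> 'M[C]_2) (psi : state C Q) : state C Q :=
  [ffun x : bits Q => \sum_(y : bits Q) (\prod_q U q (x q) (y q)) * psi y].

Definition max_entangled (C : numClosedFieldType) (Q : finType)
    (psi : state C Q) : Prop :=
  exists2 U : Q -> 'M[C]_2,
    (forall q, U q \is unitarymx) & psi = tensor_apply U (ghz C Q).

(** * Hypergraphs *)

Definition meets (S : finType) : rel {set S} :=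
  [rel A B | A :&: B != set0].

(* The nonempty sequence E :: p is a hyperpath of (S, F) from a to b. *)
Definition hyperpath (S : finType) (F : {set {set S}}) (a b : S)
    (E : {set S}) (p : seq {set S}) : bool :=
  [&& all (mem F) (E :: p), path (@meets S) E p, a \in E & b \in last E p].

Definition hconnected (S : finType) (F : {set {set S}}) : Prop :=
  forall a b : S, exists E p, hyperpath F a b E p.

(** * The initial joint state *)

Definition hedge (S : finType) (F : {set {set S}}) := {E : {set S} | E \in F}.

Definition member (S : finType) (F : {set {set S}}) (E : hedge F) :=
  {a : S | a \in val E}.

(* One qubit for every incidence between a hyperedge and an agent, together
   with [anc a] ancilla qubits for every agent a. *)
Definition qubit (S : finType) (F : {set {set S}}) (anc : S -> nat) : finType :=
  ({E : hedge F & member E} + {a : S & 'I_(anc a)})%type.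

Definition holder (S : finType) (F : {set {set S}}) (anc : S -> nat)
    (q : qubit F anc) : S :=
  match q with
  | inl e => val (tagged e)
  | inr z => tag z
  end.

(* The tensor product of the states phi E, over the hyperedges E, with the
   ancillas in state |0>. *)
Definition initial_state (C : numClosedFieldType) (S : finType)
    (F : {set {set S}}) (anc : S -> nat)
    (phi : forall E : hedge F, state C (member E)) : state C (qubit F anc) :=
  [ffun x : bits (qubit F anc) =>
    (\prod_(E : hedge F)
       phi E [ffun a : member E => x (inl (existT (@member S F) E a))]) *
    (\prod_(z : {a : S & 'I_(anc a)}) (x (inr z) == ord0)%:R)].

(** * Local operations and classical communication

    Below, Q is a register whose qubit q is held by the agent [own q]. *)

Definition held (S Q : finType) (own : Q -> S) (a : S) := {q : Q | own q == a}.

(* A linear operator on the joint state space of all qubits held by a; the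
   rows and columns are indexed by [bits (held own a)] through [enum_rank]. *)
Definition local_op (C : numClosedFieldType) (S Q : finType) (own : Q -> S)
    (a : S) :=
  'M[C]_#|{: bits (held own a)}|.

Definition view (S Q : finType) (own : Q -> S) (a : S) (x : bits Q) :
    bits (held own a) :=
  [ffun q => x (val q)].

Definition update (S Q : finType) (own : Q -> S) (a : S) (x : bits Q)
    (y : bits (held own a)) : bits Q :=
  [ffun q => if insub q is Some q' then y q' else x q].

(* The operator A (x) 1, where the identity acts on the qubits not held by a. *)
Definition local_apply (C : numClosedFieldType) (S Q : finType) (own : Q -> S)
    (a : S) (A : local_op C own a) (psi : state C Q) : state C Q :=
  [ffun x : bits Q => \sum_(y : bits (held own a))
     A (enum_rank (view own a x)) (enum_rank y) * psi (update x y)].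

(* The classical data known to an agent: its measurement outcomes and the bits
   it has received, most recent first. *)
Definition memory := seq nat.

(* Every instruction is executed by an agent a and depends only on the current
   memory of a.  A measurement is given by operators M_0, ..., M_(k-1) with
   \sum_j M_j^* M_j = 1; the outcome j is stored in the memory of a. *)
Inductive instruction (C : numClosedFieldType) (S Q : finType) (own : Q -> S) :=
| Unitary (a : S) (U : memory -> local_op C own a)
    of (forall m, U m \is unitarymx)
| Measure (a : S) (k : nat) (M : memory -> 'I_k -> local_op C own a)
    of (forall m, \sum_(j < k) (M m j)^t* *m M m j = 1%:M)
| Send (a b : S) (f : memory -> bool).

Definition config (C : numClosedFieldType) (S Q : finType) :=
  ({ffun S -> memory} * state C Q)%type.

Definition record (S : finType) (mem : {ffun S -> memory}) (a : S) (r : nat) :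
    {ffun S -> memory} :=
  [ffun b => if b == a then r :: mem b else mem b].

(* [exec i c c'] : c' is a possible configuration after i is executed in c.
   The outcome j of a measurement occurs with probability the squared norm of
   M_j psi; it is possible if and only if M_j psi is nonzero. *)
Definition exec (C : numClosedFieldType) (S Q : finType) (own : Q -> S)
    (i : instruction C own) (c c' : config C S Q) : Prop :=
  match i with
  | Unitary a U _ => c' = (c.1, local_apply (U (c.1 a)) c.2)
  | Measure a k M _ =>
      exists j : 'I_k, let psi := local_apply (M (c.1 a) j) c.2 in
        psi != 0 /\ c' = (record c.1 a j, normalize psi)
  | Send a b f => c' = (record c.1 b (f (c.1 a)), c.2)
  end.

Fixpoint run (C : numClosedFieldType) (S Q : finType) (own : Q -> S)
    (p : seq (instruction C own)) (c c' : config C S Q) : Prop :=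
  if p is i :: p' then exists2 d, exec i c d & run p' d c' else c' = c.

(* The qubits [out a], for a in S, are in the state psi, in tensor product with
   the remaining qubits.  Since rest is not constrained to have norm 1, it
   absorbs the global phase. *)
Definition prepared_on (C : numClosedFieldType) (S Q : finType) (out : S -> Q)
    (psi : state C S) (chi : state C Q) : Prop :=
  exists rest : state C {q : Q | q \notin codom out}, forall x : bits Q,
    chi x = psi [ffun a => x (out a)] * rest [ffun q => x (val q)].

Definition LOCC_preparable (C : numClosedFieldType) (S : finType)
    (F : {set {set S}}) (phi : forall E : hedge F, state C (member E))
    (psi : state C S) : Prop :=
  exists (anc : S -> nat) (out : S -> qubit F anc)
      (p : seq (instruction C (@holder S F anc))),
    (forall a, holder (out a) = a) /\
    (forall c, run p ([ffun=> [::]], initial_state anc phi) c ->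
       prepared_on out psi c.2).

(* Main.v *)
(** Necessity: if H is disconnected, the agents split into two nonempty sides
    with no hyperedge across, so the initial state is a product state for this
    bipartition.  Local operations keep it a product state, whereas a maximally
    entangled state is not one.

    Sufficiency: up to local unitaries, the hyperedges share the sum, over all
    labellings f of the hyperedges by bits, of the basis states in which each
    qubit of E carries f(E).  Every agent a measures its bits up to a global
    flip: outcome y projects on the span of |y> and of its bitwise complement,
    and maps this span isometrically onto the output qubit of a, the other
    qubits of a being reset to |0>.  Two labellings compatible with all outcomes
    agree or disagree on all the hyperedges at any given agent; as H is
    connected, they are equal or complementary.  Hence the output qubits are left in
    (|s> + |~s>)/sqrt 2 for some s depending on the outcomes.  The outcomes are
    broadcast and agent a applies a bit flip when s(a) = 1. *)

Require Import Defs.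
From mathcomp Require Import all_boot all_order fingroup perm all_algebra.
From mathcomp Require Import sesquilinear spectral.
From mathcomp Require Import boolp.
From mathcomp Require Import reals complex.

Set Implicit Arguments.
Unset Strict Implicit.
Unset Printing Implicit Defensive.

Import Order.TTheory GRing.Theory Num.Theory.
Local Open Scope ring_scope.
Local Open Scope sesquilinear_scope.

(** * Bits, finite functions and indicator products *)

Lemma ord2_neq (i j : 'I_2) : (i != j) = (i == rev_ord j).
Proof. by case: i j => [[|[|i]] hi] [[|[|j]] hj]. Qed.

Lemma ffun_neq0 (T : finType) (V : nmodType) (f : {ffun T -> V}) :
  f != 0 -> exists x, f x != 0.
Proof.
move=> f0; apply/existsP; apply: contraNT f0; rewrite negb_exists => /forallP f0.
by apply/eqP/ffunP => x; rewrite ffunE; apply/eqP; rewrite -[_ == _]negbK.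
Qed.

Lemma unitarymx_tC (C : numClosedFieldType) n (U : 'M[C]_n) :
  U \is unitarymx -> U^t* *m U = 1%:M.
Proof. by move/unitarymxP/mulmx1C. Qed.

Lemma prodr_natb (R : comNzSemiRingType) (I : finType) (B : pred I) :
  \prod_i (B i)%:R = [forall i, B i]%:R :> R.
Proof.
have [/forallP b|] := boolP [forall i, B i].
  by rewrite big1 // => i _; rewrite b.
by rewrite negb_forall => /existsP[i /negPf bi]; rewrite (bigD1 i) //= bi mul0r.
Qed.

Lemma ffun_eqE (T : finType) (R : eqType) (f g : {ffun T -> R}) :
  (f == g) = [forall x, f x == g x].
Proof.
apply/eqP/forallP => [-> x|e]; first exact: eqxx.
by apply/ffunP => x; apply/eqP.
Qed.

(** * Tensor products of single-qubit operators *)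

Section TensorKernel.
Variables (C : numClosedFieldType) (Q : finType).
Implicit Types (U V : Q -> 'M[C]_2) (x y z : bits Q).

Lemma tensor_kernelM U V x z :
  \sum_(y : bits Q) (\prod_q U q (x q) (y q)) * (\prod_q V q (y q) (z q))
  = \prod_q (U q *m V q) (x q) (z q).
Proof.
under [LHS]eq_bigr => y _ do rewrite -big_split /=.
rewrite -(bigA_distr_bigA (fun q j => U q (x q) j * V q j (z q))).
by apply: eq_bigr => q _; rewrite mxE.
Qed.

Lemma tensor_kernel1 x z : \prod_q (1%:M : 'M[C]_2) (x q) (z q) = (x == z)%:R.
Proof. by rewrite ffun_eqE -prodr_natb; apply: eq_bigr => q _; rewrite mxE. Qed.

(** The Kronecker product of the [V q], in the indexing of [local_op], so that an agent can apply it
    to its register. *)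
Definition tensor_mx V : 'M[C]_#|{: bits Q}| :=
  \matrix_(i, j) \prod_q V q ((enum_val i : bits Q) q) ((enum_val j : bits Q) q).

Lemma tensor_mx_unitary V :
  (forall q, V q \is unitarymx) -> tensor_mx V \is unitarymx.
Proof.
move=> hV; apply/unitarymxP/matrixP => i j; rewrite !mxE.
transitivity (\prod_q (V q *m (V q)^t*) ((enum_val i : bits Q) q) ((enum_val j : bits Q) q)).
  rewrite -tensor_kernelM (reindex enum_rank) /=; last exact/onW_bij/enum_rank_bij.
  apply: eq_bigr => y _; rewrite !mxE enum_rankK rmorph_prod; congr (_ * _).
  by apply: eq_bigr => q _; rewrite !mxE.
under eq_bigr => q _ do rewrite (unitarymxP (hV q)).
by rewrite tensor_kernel1 (inj_eq enum_val_inj).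
Qed.

(** Only the two constant strings have nonzero amplitude in the GHZ state. The remaining bit [c]
    will become the label of a hyperedge. *)
Lemma tensor_apply_ghz V x :
  tensor_apply V (ghz C Q) x
  = (sqrtC 2)^-1 * \sum_(c < 2) \prod_q V q (x q) c.
Proof.
rewrite ffunE big_ord_recl big_ord1 !mulrDr.
rewrite (eq_bigr (fun y => (sqrtC 2)^-1 * ((\prod_q V q (x q) (y q)) * (y == [ffun=> ord0])%:R)
  + (sqrtC 2)^-1 * ((\prod_q V q (x q) (y q)) * (y == [ffun=> ord_max])%:R))).
  rewrite big_split /= -!mulr_sumr; congr (_ * _ + _ * _).
    rewrite (bigD1 [ffun=> ord0]) //= eqxx mulr1 [X in _ + X]big1 ?addr0.
      by apply: eq_bigr => q _; rewrite ffunE.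
    by move=> y /negPf->; rewrite mulr0.
  rewrite (bigD1 [ffun=> ord_max]) //= eqxx mulr1 [X in _ + X]big1 ?addr0.
    by apply: eq_bigr => q _; rewrite ffunE; congr (V q _ _); apply: val_inj.
  by move=> y /negPf->; rewrite mulr0.
by move=> y _; rewrite ffunE mulrCA mulrDr mulrDr.
Qed.

Lemma ghz_max_entangled : max_entangled (ghz C Q).
Proof.
exists (fun=> 1%:M) => [q|]; first by apply/unitarymxP; rewrite mul1mx trmx1 map_mx1.
apply/ffunP => x; rewrite tensor_apply_ghz big_ord_recl big_ord1 ffunE.
rewrite !ffun_eqE -!prodr_natb; congr (_ * (_ + _)); apply: eq_bigr => q _;
  by rewrite !mxE ffunE //; congr (_ == _)%:R; apply: val_inj.
Qed.

End TensorKernel.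

(** * Product states and necessity *)

Section LocalOperations.
Variables (C : numClosedFieldType) (S Q : finType) (own : Q -> S).
Implicit Types (a b : S) (x : bits Q) (psi : state C Q).

Lemma view_update a x (y : bits (held own a)) : view own a (update x y) = y.
Proof. by apply/ffunP => q; rewrite !ffunE valK. Qed.

Lemma view_update_neq a b x (y : bits (held own a)) :
  b != a -> view own b (update x y) = view own b x.
Proof.
move=> ab; apply/ffunP => q; rewrite !ffunE insubN //.
by rewrite (eqP (valP q)).
Qed.

Lemma update_update a x (y z : bits (held own a)) :
  update (update x y) z = update x z.
Proof. by apply/ffunP => q; rewrite !ffunE; case: insub. Qed.

Lemma update_view a x : update x (view own a x) = x.
Proof.
apply/ffunP => q; rewrite !ffunE; case: insubP => // q' _ <-.
by rewrite ffunE.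
Qed.

Lemma local_apply1 a psi : local_apply (1%:M : local_op C own a) psi = psi.
Proof.
apply/ffunP => x; rewrite ffunE (bigD1 (view own a x)) //= big1 => [|y yx].
  by rewrite update_view mxE eqxx mul1r addr0.
by rewrite mxE (inj_eq enum_rank_inj) eq_sym (negPf yx) mul0r.
Qed.

Lemma local_applyM a (A B : local_op C own a) psi :
  local_apply (A *m B) psi = local_apply A (local_apply B psi).
Proof.
apply/ffunP => x; rewrite !ffunE.
under eq_bigr => z _ do rewrite mxE mulr_suml.
rewrite exchange_big (reindex enum_rank) /=; last exact/onW_bij/enum_rank_bij.
apply: eq_bigr => y _; rewrite ffunE mulr_sumr; apply: eq_bigr => z _.
by rewrite view_update update_update mulrA.
Qed.

Lemma local_apply_suml a (I : finType) (A : I -> local_op C own a) psi :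
  local_apply (\sum_i A i) psi = \sum_i local_apply (A i) psi.
Proof.
apply/ffunP => x; rewrite sum_ffunE ffunE.
under eq_bigr => y _ do rewrite summxE mulr_suml.
by rewrite exchange_big; apply: eq_bigr => i _; rewrite ffunE.
Qed.

Lemma local_apply0 a (A : local_op C own a) : local_apply A 0 = 0.
Proof. by apply/ffunP => x; rewrite !ffunE big1 // => y _; rewrite ffunE mulr0. Qed.

Lemma normalizeE psi :
  psi != 0 -> exists2 k : C, k != 0 & normalize psi = [ffun x => k * psi x].
Proof.
case/ffun_neq0 => x x0; exists (sqrtC (\sum_y `|psi y| ^+ 2))^-1; last by [].
rewrite invr_eq0 sqrtC_eq0 psumr_neq0 => [|y _]; last exact: exprn_ge0.
by apply/hasP; exists x; rewrite ?mem_index_enum //= exprn_gt0 // normr_gt0.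
Qed.


Lemma normalize_neq0 psi : psi != 0 -> normalize psi != 0.
Proof.
move=> psi0; have [k k0 ->] := normalizeE psi0.
case/ffun_neq0: psi0 => x x0; apply/eqP => /ffunP/(_ x)/eqP.
by rewrite !ffunE mulf_eq0 (negPf k0) (negPf x0).
Qed.

Lemma exec_neq0 (i : instruction C own) c c' :
  c.2 != 0 -> exec i c c' -> c'.2 != 0.
Proof.
case: i => [a U hU|a k M _|a b f] c0 /=; last by move->.
- move=> ->; apply: contra c0 => /= /eqP e0; apply/eqP.
  by rewrite -[c.2](@local_apply1 a) -(unitarymx_tC (hU (c.1 a))) local_applyM e0
     local_apply0.
- by case=> j [psi0 ->] /=; apply: normalize_neq0.
Qed.

(** If every [M_j psi] were 0, then [psi], the sum of the [M_j^* M_j psi], would be 0. Necessity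
    relies on this: preparability speaks of all runs, so a run must exist. *)
Lemma exec_total (i : instruction C own) c :
  c.2 != 0 -> exists c', exec i c c'.
Proof.
case: i => [a U hU|a k M hM|a b f] c0; [by eexists| |by eexists].
have /existsP[j j0] : [exists j, local_apply (M (c.1 a) j) c.2 != 0].
  apply: contraNT c0; rewrite negb_exists => /forallP M0; apply/eqP.
  rewrite -[c.2](@local_apply1 a) -(hM (c.1 a)) local_apply_suml big1 // => j _.
  by have /negPn/eqP := M0 j; rewrite local_applyM => ->; rewrite local_apply0.
by eexists; exists j; split.
Qed.

Lemma run_neq0 (p : seq (instruction C own)) c c' :
  c.2 != 0 -> run p c c' -> c'.2 != 0.
Proof.
elim: p c => [|i p IH] c c0 /=; first by move->.
by case=> d /(exec_neq0 c0) d0; apply: IH.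
Qed.

Lemma run_total (p : seq (instruction C own)) c :
  c.2 != 0 -> exists c', run p c c'.
Proof.
elim: p c => [|i p IH] c c0 /=; first by exists c.
have [d cd] := exec_total i c0; have [c' dc'] := IH d (exec_neq0 c0 cd).
by exists c', d.
Qed.

End LocalOperations.

(** * Product states across a bipartition of the qubits *)

Section Separability.
Variables (C : numClosedFieldType) (Q : finType) (D : pred Q).
Implicit Types (x y : bits Q) (psi : state C Q).

Definition mix x y : bits Q := [ffun q => if D q then x q else y q].

(* For a pure state this says that psi is a product state across the
   bipartition of the qubits into D and its complement. *)
Definition separable psi :=
  forall x y, psi x * psi y = psi (mix x y) * psi (mix y x).

Lemma mix_mix x y : mix (mix x y) (mix y x) = x.
Proof. by apply/ffunP => q; rewrite !ffunE; case: (D q). Qed.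

Lemma mix_pair_bij : bijective (fun xy : bits Q * bits Q => (mix xy.1 xy.2, mix xy.2 xy.1)).
Proof. by apply: inv_bij => -[x y] /=; rewrite !mix_mix. Qed.

Lemma separable_scale (k : C) psi : separable psi -> separable [ffun x => k * psi x].
Proof. by move=> sep x y; rewrite !ffunE mulrACA sep mulrACA. Qed.

(** Exchanging the parts outside [D] of the two summation indices is an involution. It matches the
    kernels qubit by qubit, and the amplitudes by separability. *)
Lemma separable_tensor_apply (U : Q -> 'M[C]_2) psi :
  separable psi -> separable (tensor_apply U psi).
Proof.
move=> sep x y; rewrite !ffunE !big_distrlr /= !pair_bigA /=.
rewrite [RHS](reindex _ (onW_bij _ mix_pair_bij)) /=; apply: eq_bigr => -[z w] _ /=.
rewrite mulrACA [RHS]mulrACA -sep -!big_split /=; congr (_ * _).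
by apply: eq_bigr => q _; rewrite !ffunE; case: (D q) => //; rewrite mulrC.
Qed.

End Separability.

(** * LOCC preserves product states *)

Section SeparableRuns.
Variables (C : numClosedFieldType) (S Q : finType) (own : Q -> S) (T : {set S}).
Let D : pred Q := fun q => own q \in T.

(** All qubits of [a] lie on one side of the cut, so mixing two strings either keeps or exchanges
    their views by [a]. *)
Lemma separable_local_apply a (A : local_op C own a) (psi : state C Q) :
  separable D psi -> separable D (local_apply A psi).
Proof.
move=> sep x y; rewrite !ffunE !big_distrlr /=.
have view_mix u v : view own a (mix D u v) = view own a (if a \in T then u else v).
  by apply/ffunP => q; rewrite !ffunE /D (eqP (valP q)); case: ifP.
have update_mix u v (z w : bits (held own a)) : update (mix D u v) (if a \in T then z else w)
    = mix D (update u z) (update v w) :> bits Q.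
  apply/ffunP => q; rewrite !ffunE; case: insubP => //= q' /eqP aq _.
  by rewrite /D aq; case: ifP.
rewrite !view_mix; case: ifP update_mix => aT update_mix.
  apply: eq_bigr => z _; apply: eq_bigr => w _.
  by rewrite mulrACA [RHS]mulrACA sep (update_mix x y z w) (update_mix y x w z).
(* For [a] outside [T] the mixed strings have exchanged views, hence the exchange of the two
   summations. *)
rewrite exchange_big; apply: eq_bigr => z _; apply: eq_bigr => w _.
rewrite [LHS]mulrACA [RHS]mulrACA sep (update_mix x y w z) (update_mix y x z w).
by congr (_ * _); rewrite mulrC.
Qed.

Lemma separable_run (p : seq (instruction C own)) c c' :
  run p c c' -> separable D c.2 -> separable D c'.2.
Proof.
elim: p c => [|i p IH] c /=; first by move->.
case=> d cd /IH{}IH sep; apply: IH; case: i cd => [a U hU|a k M hM|a b f] /=.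
- by move->; apply: separable_local_apply.
- case=> j [psi0 ->] /=; have [k' _ ->] := normalizeE psi0.
  exact/separable_scale/separable_local_apply.
- by move->.
Qed.

End SeparableRuns.

(** * Maximally entangled states are nonzero and not product states *)

Section MaxEntangled.
Variables (C : numClosedFieldType) (Q : finType).
Implicit Types psi : state C Q.

Lemma tensor_apply_tCK (U : Q -> 'M[C]_2) psi :
  (forall q, U q \is unitarymx) ->
  tensor_apply (fun q => (U q)^t*) (tensor_apply U psi) = psi.
Proof.
move=> hU; apply/ffunP => x; rewrite ffunE.
under eq_bigr => y _ do rewrite ffunE mulr_sumr.
rewrite exchange_big /= (bigD1 x) //= [X in _ + X]big1 ?addr0 => [|z zx];
  under eq_bigr => y _ do rewrite mulrA;
  rewrite -mulr_suml tensor_kernelM;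
  under eq_bigr => q _ do rewrite (unitarymx_tC (hU q));
  by rewrite tensor_kernel1 1?eq_sym ?eqxx ?mul1r // (negPf zx) mul0r.
Qed.

Lemma ghz_neq0 : ghz C Q != 0.
Proof.
apply/eqP => /ffunP/(_ [ffun=> ord0])/eqP; rewrite !ffunE eqxx.
rewrite mulf_eq0 invr_eq0 sqrtC_eq0 pnatr_eq0 /=.
by rewrite -natrD pnatr_eq0.
Qed.

Lemma max_entangled_neq0 psi : max_entangled psi -> psi != 0.
Proof.
case=> U hU ->; apply: contra ghz_neq0 => /eqP e0.
rewrite -(tensor_apply_tCK (ghz C Q) hU) e0; apply/eqP/ffunP => x.
by rewrite !ffunE big1 // => y _; rewrite ffunE mulr0.
Qed.

(** Undoing the local unitaries keeps separability and leaves the GHZ state. There the all-0 and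
    all-1 strings have nonzero amplitude, while their mixtures, non-constant because of [q] and [r],
    have amplitude 0. *)
Lemma max_entangled_not_separable (D : pred Q) psi q r :
  D q -> ~~ D r -> max_entangled psi -> ~ separable D psi.
Proof.
move=> Dq Dr [U hU ->] /separable_tensor_apply - /(_ (fun q => (U q)^t*)).
rewrite tensor_apply_tCK // => /(_ [ffun=> ord0] [ffun=> ord_max]); rewrite !ffunE !eqxx.
have neq (x : bits Q) i j : x q != i -> x r != j ->
    (x == [ffun=> i]) = false /\ (x == [ffun=> j]) = false.
  by move=> xi xj; split; apply/eqP => e; [move: xi|move: xj]; rewrite e ffunE eqxx.
have [||-> ->] := neq (mix D [ffun=> ord0] [ffun=> ord_max]) ord_max ord0;
  rewrite ?ffunE ?Dq ?(negPf Dr) ?ffunE //.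
have [||-> ->] := neq (mix D [ffun=> ord_max] [ffun=> ord0]) ord0 ord_max;
  rewrite ?ffunE ?Dq ?(negPf Dr) ?ffunE //.
have -> : ([ffun=> ord0] == [ffun=> ord_max] :> bits Q) = false.
  by apply/eqP => /ffunP/(_ q); rewrite !ffunE.
rewrite eq_sym.
have -> : ([ffun=> ord0] == [ffun=> ord_max] :> bits Q) = false.
  by apply/eqP => /ffunP/(_ q); rewrite !ffunE.
move/eqP; rewrite /= !(mulr0n, mulr1n, addr0, add0r, mulr1, mulr0, mul0r) mulf_eq0 orbb.
by rewrite invr_eq0 sqrtC_eq0 pnatr_eq0.
Qed.

End MaxEntangled.

(** * Necessity: cuts crossed by no hyperedge *)

Section Necessity.
Variables (C : numClosedFieldType) (S : finType) (F : {set {set S}}).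
Variable phi : forall E : hedge F, state C (member E).
Hypothesis phi_max : forall E, max_entangled (phi E).

Lemma initial_state_neq0 anc : initial_state anc phi != 0.
Proof.
have y0 E : {y | phi E y != 0} by exact/cid/ffun_neq0/max_entangled_neq0.
pose y E := sval (y0 E).
pose x : bits (qubit F anc) :=
  [ffun q => match q with inl e => y (tag e) (tagged e) | inr _ => ord0 end].
apply/eqP => /ffunP/(_ x)/eqP; rewrite !ffunE [X in _ * X]big1 => [|z _];
  last by rewrite ffunE eqxx.
rewrite mulr1 (_ : \prod_E _ = \prod_E phi E (y E)).
  by apply/negP/prodf_neq0 => E _; apply: svalP (y0 E).
by apply: eq_bigr => E _; congr (phi E _); apply/ffunP => a; rewrite !ffunE.
Qed.

(** Each hyperedge or ancilla lies on one side, so mixing keeps or swaps its two factors. *)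
Lemma separable_initial_state anc (T : {set S}) :
  (forall E, E \in F -> (E \subset T) || (E \subset ~: T)) ->
  separable (fun q => holder q \in T) (initial_state anc phi).
Proof.
move=> cutF x y; rewrite !ffunE mulrACA [RHS]mulrACA -!big_split /=; congr (_ * _).
  apply: eq_bigr => E _; have [ET|/subsetP ET] := orP (cutF _ (valP E)).
    congr (phi E _ * phi E _); apply/ffunP => a;
      by rewrite !ffunE /= (subsetP ET _ (valP a)).
  rewrite mulrC; congr (phi E _ * phi E _); apply/ffunP => a; rewrite !ffunE /=;
    by have := ET _ (valP a); rewrite inE => /negPf->.
apply: eq_bigr => z _; rewrite !ffunE /=.
by case: ifP => // _; rewrite mulrC.
Qed.

(** The final state is a product across the cut. Freezing the qubits outside the output passes this
    property on to [psi], a contradiction. *)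
Lemma not_LOCC_preparable_cut (T : {set S}) a b psi :
  (forall E, E \in F -> (E \subset T) || (E \subset ~: T)) ->
  a \in T -> b \notin T -> max_entangled psi -> ~ LOCC_preparable phi psi.
Proof.
move=> cutF aT bT psi_max [anc [out [p [hout hp]]]].
have init0 := initial_state_neq0 anc.
have [c runc] := run_total p (c := ([ffun=> [::]], _)) init0.
have chi0 : c.2 != 0 := run_neq0 (c := ([ffun=> [::]], _)) init0 runc.
have sep := separable_run runc (separable_initial_state (anc := anc) cutF).
have [rest hrest] := hp c runc.
have [x0 x00] := ffun_neq0 chi0.
pose lift (u : bits S) : bits (qubit F anc) :=
  [ffun q => if out (holder q) == q then u (holder q) else x0 q].
pose w : bits {q | q \notin codom out} := [ffun q => x0 (val q)].
have liftE u : c.2 (lift u) = psi u * rest w.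
  rewrite hrest; congr (psi _ * rest _); apply/ffunP => q; rewrite !ffunE.
    by rewrite hout eqxx.
  case: eqP => // e; case/negP: (valP q); rewrite -e; exact: codom_f.
have rest0 : rest w != 0.
  by apply: contraNneq x00 => e; rewrite hrest -/w e mulr0.
apply: (max_entangled_not_separable aT bT psi_max) => u v.
have mix_lift s t : mix (fun q => holder q \in T) (lift s) (lift t)
    = lift (mix (mem T) s t).
  by apply/ffunP => q; rewrite !ffunE /=; do 2!case: ifP.
apply: (mulIf (mulf_neq0 rest0 rest0)).
rewrite mulrACA -!liftE [RHS]mulrACA -!liftE -!mix_lift; exact: sep.
Qed.

Lemma LOCC_preparable_connected psi :
  (1 < #|S|)%N -> max_entangled psi -> LOCC_preparable phi psi -> hconnected F.
Proof.
move=> S2 psi_max prep a b; apply: contrapT => nab.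
(* The component of [a]; [a] is added by hand because an agent in no hyperedge has no hyperpath even
   to itself. *)
pose T := a |: [set c | `[< exists E p, hyperpath F a c E p >]].
have TE c : c \in T -> c = a \/ exists E p, hyperpath F a c E p.
  by rewrite !inE => /predU1P[|/asboolP]; [left|right].
have [c cT] : exists c, c \notin T.
  (* If [b = a], then [a] lies in no hyperedge, and any second agent is outside [T]. *)
  have [ab|ba] := eqVneq b a; last first.
    by exists b; rewrite !inE (negPf ba) //; apply/asboolPn.
  have /card_gt0P[c] : (0 < #|[set~ a]|)%N by rewrite cardsC1; case: #|S| S2 => [|[]].
  rewrite !inE => ca; exists c; rewrite !inE (negPf ca); apply/asboolPn => -[E [p]].
  case/and4P=> /= /andP[EF _] _ aE _; apply: nab; exists E, [::].
  by rewrite ab /hyperpath /= EF aE.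
apply: (not_LOCC_preparable_cut (T := T) (a := a) (b := c)) psi_max prep; rewrite ?setU11 //.
move=> E EF; have [|ET] := boolP (E \subset ~: T); rewrite ?orbT ?orbF //.
have [x xE xT] : exists2 x, x \in E & x \in T.
  by case/subsetPn: ET => x xE; rewrite inE negbK; exists x.
apply/subsetP => y yE; rewrite !inE; apply/orP; right; apply/asboolP.
have [<-|[E1 [p /and4P[/= /andP[E1F pF] path_p aE1 xl]]]] := TE x xT.
  by exists E, [::]; rewrite /hyperpath /= EF xE yE.
exists E1, (rcons p E); rewrite /hyperpath /= E1F all_rcons pF aE1 last_rcons yE /=.
rewrite rcons_path path_p !andbT EF /=.
by apply/set0Pn; exists x; rewrite inE xl.
Qed.

End Necessity.

(** * The protocol *)

Section ProductStates.
Variables (C : numClosedFieldType) (S Q : finType) (own : Q -> S).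

Definition local_vec (a : S) := 'cV[C]_#|{: bits (held own a)}|.

Definition product_state (v : forall a, local_vec a) : state C Q :=
  [ffun x => \prod_a v a (enum_rank (view own a x)) 0].

(** The form of the joint state throughout the protocol: [i] is a labelling, an operation of [a]
    changes the factor at [a] in every term, and [k] absorbs the normalizations. *)
Definition product_sum (I : finType) (k : C) (v : I -> forall a, local_vec a) :
    state C Q :=
  [ffun x => k * \sum_i product_state (v i) x].

Lemma local_apply_product_state a (A : local_op C own a) v w :
  w a = A *m v a -> (forall b, b != a -> w b = v b) ->
  local_apply A (product_state v) = product_state w.
Proof.
move=> wa wb; apply/ffunP => x; rewrite !ffunE (bigD1 a) //= wa mxE mulr_suml.
rewrite [RHS](reindex enum_rank) /=; last exact/onW_bij/enum_rank_bij.
apply: eq_bigr => y _; rewrite ffunE (bigD1 a) //= view_update mulrA; congr (_ * _).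
by apply: eq_bigr => b ba; rewrite view_update_neq // wb.
Qed.

Lemma local_apply_product_sum (I : finType) a (A : local_op C own a) k
    (v w : I -> forall a, local_vec a) :
  (forall i, w i a = A *m v i a) -> (forall i b, b != a -> w i b = v i b) ->
  local_apply A (product_sum k v) = product_sum k w.
Proof.
move=> wa wb; apply/ffunP => x; rewrite !ffunE.
transitivity (\sum_(y : bits (held own a)) \sum_i
    k * (A (enum_rank (view own a x)) (enum_rank y) * product_state (v i) (update x y))).
  by apply: eq_bigr => y _; rewrite ffunE mulrCA !mulr_sumr.
rewrite exchange_big mulr_sumr; apply: eq_bigr => i _ /=.
rewrite -mulr_sumr; congr (k * _).
by rewrite -(local_apply_product_state (wa i) (wb i)) ffunE.
Qed.

Lemma eq_product_sum (I : finType) k (v w : I -> forall a, local_vec a) :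
  (forall i a, v i a = w i a) -> product_sum k v = product_sum k w.
Proof.
move=> vw; apply/ffunP => x; rewrite !ffunE; congr (_ * _); apply: eq_bigr => i _.
by rewrite !ffunE; apply: eq_bigr => a _; rewrite vw.
Qed.

Lemma normalize_product_sum (I : finType) k (v : I -> forall a, local_vec a) :
  product_sum k v != 0 -> exists k', normalize (product_sum k v) = product_sum k' v.
Proof.
case/normalizeE => r _ ->; exists (r * k).
by apply/ffunP => x; rewrite !ffunE mulrA.
Qed.

Lemma prod_held (G : Q -> C) : \prod_q G q = \prod_a \prod_(q : held own a) G (val q).
Proof.
rewrite (partition_big own xpredT) //=; apply: eq_bigr => a _.
exact: (big_sub (fun q => own q == a)).
Qed.

Definition ket a (y : bits (held own a)) : local_vec a := delta_mx (enum_rank y) 0.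

Lemma ketE a (y z : bits (held own a)) : ket y (enum_rank z) 0 = (z == y)%:R.
Proof. by rewrite mxE eqxx andbT (inj_eq enum_rank_inj). Qed.

Lemma product_state_tensor (V : Q -> 'M[C]_2) (y : bits Q) x :
  product_state (fun a => tensor_mx (fun q : held own a => V (val q)) *m ket (view own a y)) x
  = \prod_q V q (x q) (y q).
Proof.
rewrite ffunE prod_held; apply: eq_bigr => a _.
rewrite -colE !mxE !enum_rankK; apply: eq_bigr => q _; by rewrite !ffunE.
Qed.

End ProductStates.

(** * Exchange of two basis vectors; bitwise complement *)

Lemma tperm_mx_delta (R : nzSemiRingType) n (i j : 'I_n) :
  tperm_mx i j *m delta_mx i 0 = delta_mx j 0 :> 'cV[R]_n.
Proof.
rewrite -xrowE; apply/matrixP => r c; rewrite !mxE; congr (_ && _)%:R.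
by rewrite (canF_eq (tpermK i j)) tpermL.
Qed.

Lemma tperm_mx_unitary (C : numClosedFieldType) n (i j : 'I_n) :
  (tperm_mx i j : 'M[C]_n) \is unitarymx.
Proof.
by apply/unitarymxP; rewrite tr_tperm_mx map_tperm_mx -perm_mxM tperm2 perm_mx1.
Qed.

Definition flip (Q : finType) (x : bits Q) : bits Q := [ffun q => rev_ord (x q)].

Lemma flipK (Q : finType) : involutive (@flip Q).
Proof. by move=> x; apply/ffunP => q; rewrite !ffunE rev_ordK. Qed.

Lemma flip_neq (Q : finType) (q : Q) (x : bits Q) : (flip x == x) = false.
Proof.
apply/eqP => /ffunP/(_ q); rewrite ffunE.
by case: (x q) => -[|[|i]] hi /(congr1 val).
Qed.

(** * The measurement of one agent *)

Section Compression.
Variables (C : numClosedFieldType) (S Q : finType) (own : Q -> S) (out : S -> Q).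
Hypothesis own_out : forall a, own (out a) = a.
Variable a : S.
Implicit Types y z : bits (held own a).

Definition zero_bits : bits (held own a) := [ffun=> ord0].

Definition out_bits : bits (held own a) :=
  [ffun q => if val q == out a then ord_max else ord0].

Definition out_held : held own a := exist _ (out a) (introT eqP (own_out a)).

Lemma zero_out_bits : (zero_bits == out_bits) = false.
Proof. by apply/eqP => /ffunP/(_ out_held); rewrite !ffunE eqxx. Qed.

(* |0><y| + |1><flip y| up to normalization, where 0 and 1 are the values of the
   output qubit of [a] and its other qubits are reset to 0. *)
Definition compress y : local_op C own a :=
  (sqrtC 2)^-1 *: (delta_mx (enum_rank zero_bits) (enum_rank y)
                   + delta_mx (enum_rank out_bits) (enum_rank (flip y))).

Lemma compress_ket y z :
  compress y *m ket C z = (sqrtC 2)^-1 *: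
    ((y == z)%:R *: ket C zero_bits + (flip y == z)%:R *: ket C out_bits).
Proof.
rewrite -scalemxAl mulmxDl !mul_delta_mx_cond !(inj_eq enum_rank_inj).
by rewrite -!scaler_nat.
Qed.

(** Each term is half the projector on the span of [y] and [flip y]: cross terms vanish as
    [zero_bits] and [out_bits] differ. Outcomes range over all strings, so each pair is counted
    twice, which cancels the half. *)
Lemma compress_complete : \sum_y (compress y)^t* *m compress y = 1%:M.
Proof.
have sqrt2 : (sqrtC 2 : C)^-1^* * (sqrtC 2)^-1 = 2^-1.
  rewrite conj_Creal; last by rewrite rpredV ger0_real // sqrtC_ge0.
  by rewrite -expr2 exprVn sqrtCK.
have sq y : (compress y)^t* *m compress y = 2^-1 *: delta_mx (enum_rank y) (enum_rank y)
    + 2^-1 *: delta_mx (enum_rank (flip y)) (enum_rank (flip y)).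
  rewrite [(_ *: _)^T]linearZ /= map_mxZ -scalemxAr -scalemxAl scalerA mulrC sqrt2.
  rewrite -scalerDr [(_ + _)^T]linearD /= map_mxD !trmx_delta !map_delta_mx mulmxDl !mulmxDr.
  rewrite !mul_delta_mx_cond !eqxx !(inj_eq enum_rank_inj) zero_out_bits.
  by rewrite [_ == zero_bits]eq_sym zero_out_bits !mulr0n !mulr1n addr0 add0r.
rewrite (eq_bigr _ (fun y _ => sq y)) big_split /= [X in _ + X](reindex_inj (inv_inj (@flipK _))).
under [X in _ + X]eq_bigr => y _ do rewrite flipK.
rewrite -mulr2n -scaler_sumr -scaler_nat scalerA divff ?pnatr_eq0 // scale1r.
rewrite mx1_sum_delta (reindex enum_rank) //; exact/onW_bij/enum_rank_bij.
Qed.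

End Compression.

(** * Measurements, broadcast and corrections *)

Section Protocol.
Variables (C : numClosedFieldType) (S Q : finType) (own : Q -> S) (out : S -> Q).
Hypothesis own_out : forall a, own (out a) = a.
Variables (V : Q -> 'M[C]_2) (I : finType) (lab : I -> bits Q).
Hypothesis V_unitary : forall q, V q \is unitarymx.

Local Notation zero a := (@zero_bits S Q own a).
Local Notation one a := (@out_bits S Q own out a).
Local Notation instr := (instruction C own).
Local Notation mems := {ffun S -> memory}.

(** The unitaries defining the shared states, gathered at agent [a]; [measure_op] undoes them before
    compressing. *)
Definition frame a : local_op C own a := tensor_mx (fun q : held own a => V (val q)).

Lemma frame_unitary a : frame a \is unitarymx.
Proof. exact/tensor_mx_unitary. Qed.

Definition read a (r : nat) : bits (held own a) :=
  nth (zero a) (enum {: bits (held own a)}) r.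

Definition measure_op a (j : 'I_#|{: bits (held own a)}|) : local_op C own a :=
  compress C out (enum_val j) *m (frame a)^t*.

Lemma measure_op_complete a :
  \sum_j (measure_op j)^t* *m measure_op j = 1%:M :> local_op C own a.
Proof.
transitivity (frame a *m (\sum_y (compress C out y)^t* *m compress C out y) *m (frame a)^t*).
  rewrite mulmx_sumr mulmx_suml (big_enum_val (A := {: bits (held own a)})) /=.
  apply: eq_bigr => j _.
  by rewrite trmx_mul map_mxM /= trmxCK !mulmxA.
by rewrite (compress_complete C own_out) mulmx1; apply/unitarymxP/frame_unitary.
Qed.

Definition measurement a : instr := Measure (fun _ => @measure_op_complete a).

Definition encoded f a : local_vec C own a := ket C (view own a (lab f)).
Definition framed f a : local_vec C own a := frame a *m encoded f a.
Definition compressed (r : S -> nat) f a : local_vec C own a :=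
  compress C out (read a (r a)) *m encoded f a.

(** Loop invariant: agents in [l] have not measured yet, the others hold their outcome [r a] and a
    compressed factor. The values of [r] on [l] are placeholders, overwritten one by one. *)
Lemma run_measurements l (r : S -> nat) (m : mems) k v c :
  uniq l -> (forall a, m a = if a \in l then [::] else [:: r a]) ->
  (forall a, a \notin l -> (r a < #|{: bits (held own a)}|)%N) ->
  (forall f a, v f a = if a \in l then framed f a else compressed r f a) ->
  run [seq measurement a | a <- l] (m, product_sum k v) c ->
  exists k' r', [/\ forall a, (r' a < #|{: bits (held own a)}|)%N &
    c = ([ffun a => [:: r' a]], product_sum k' (compressed r'))].
Proof.
elim: l r m k v => [|a l IH] r m k v /=.
  move=> _ mE hr vE ->; exists k, r; split; first by move=> a; apply: hr.
  congr (_, _); first by apply/ffunP => a; rewrite mE ffunE.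
  exact: eq_product_sum.
case/andP=> al ul mE hr vE [d [j [psi0 ->]]].
pose r' b : nat := if b == a then val j else r b.
pose w f b := if b \in l then framed f b else compressed r' f b.
have applyE : local_apply (measure_op j) (product_sum k v) = product_sum k w.
  rewrite /w; apply: local_apply_product_sum => [f|f b ba]; rewrite vE.
    rewrite inE eqxx (negPf al) /= /framed /compressed /measure_op.
    rewrite -[RHS]mulmxA [_^t* *m _]mulmxA (unitarymx_tC (frame_unitary a)) mul1mx.
    by rewrite /r' eqxx /read -enum_val_nth.
  by rewrite inE (negPf ba) /= /compressed /r' (negPf ba).
rewrite /= applyE in psi0 *; have [k' ->] := normalize_product_sum psi0.
apply: (IH r') => // b; rewrite /r'.
  rewrite ffunE; case: (eqVneq b a) => [->|ba].
    by rewrite (negPf al) mE inE eqxx.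
  by rewrite mE inE (negPf ba).
by move=> bl; case: (eqVneq b a) => [->|ba];
  [exact: ltn_ord|apply: hr; rewrite inE negb_or ba].
Qed.

Definition nb_outcomes := \max_a #|{: bits (held own a)}|.

Local Notation values r := (fun b => nat_of_ord (r b)).

(** [Send] carries one bit, so an outcome is announced in unary, by one message for each possible
    value. *)
Definition message : finType := (S * S * 'I_nb_outcomes)%type.

(* The message (a, b, i) tells b whether the outcome of a is i.  New entries are
   pushed in front of a memory, so the outcome stays its last entry. *)
Definition send (t : message) : instr :=
  @Send C S Q own t.1.1 t.1.2 (fun m => last 0%N m == t.2).

Definition deliver (m : mems) (t : message) : mems :=
  record m t.1.2 (last 0%N (m t.1.1) == t.2).

Definition outcome_memory (r : S -> nat) : mems := [ffun a => [:: r a]].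

Definition broadcast (r : S -> nat) : mems :=
  foldl deliver (outcome_memory r) (enum message).

Lemma run_sends l c c' :
  run [seq send t | t <- l] c c' -> c' = (foldl deliver c.1 l, c.2).
Proof.
elim: l c => [|t l IH] [m psi] /=; first by [].
by case=> d -> /IH.
Qed.

Lemma deliver_nil (m : mems) t b : m b != [::] -> deliver m t b != [::].
Proof. by rewrite ffunE; case: ifP. Qed.

Lemma last_deliver (m : mems) t b : m b != [::] -> last 0%N (deliver m t b) = last 0%N (m b).
Proof. by rewrite ffunE; case: ifP => //; case: (m b). Qed.

(** Both memories of [a] grow in step, so equal final memories agree entry by entry; the announced
    outcomes never change, being last entries. *)
Lemma foldl_deliver_inj l (m m' : mems) a :
  (forall b, m b != [::]) -> (forall b, m' b != [::]) -> size (m a) = size (m' a) ->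
  foldl deliver m l a = foldl deliver m' l a ->
  m a = m' a /\ forall t, t \in l -> t.1.2 = a ->
    (last 0%N (m t.1.1) == t.2) = (last 0%N (m' t.1.1) == t.2).
Proof.
elim: l m m' => [|t l IH] m m' m0 m0' sz /=; first by [].
move=> /IH[b|b||e he]; try exact: deliver_nil.
  by rewrite !ffunE; case: ifP => //= _; rewrite sz.
split.
  by move: e; rewrite !ffunE; case: ifP => // _ [].
move=> s; rewrite inE => /predU1P[-> ta|sl sa].
  move: e; rewrite !ffunE ta eqxx => -[+ _].
  by case: (_ == _); case: (_ == _).
by have := he s sl sa; rewrite !last_deliver.
Qed.

Lemma broadcast_inj (r r' : {ffun S -> 'I_nb_outcomes}) a :
  broadcast (values r) a = broadcast (values r') a -> r = r'.
Proof.
case/foldl_deliver_inj => [b|b||_ h]; rewrite ?ffunE //.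
(* The message asking whether the outcome of [b] is [r b] is answered positively under [r], hence
   under [r']. *)
apply/ffunP => b; have := h (b, a, r b) (mem_enum _ _) erefl.
by rewrite !ffunE /= eqxx => /esym/eqP e; apply: val_inj.
Qed.

(** The labellings whose terms are not annihilated by the outcomes [r]. *)
Definition consistent (r : S -> nat) f :=
  [forall a, (view own a (lab f) == read a (r a))
          || (view own a (lab f) == flip (read a (r a)))].

(** All agents derive the same reference labelling [f] from [r]. The default [false] concerns only
    outcomes of zero amplitude. *)
Definition needs_flip (r : S -> nat) a :=
  if [pick f | consistent r f] is Some f then view own a (lab f) != read a (r a)
  else false.

Definition correct (r : S -> nat) a : local_op C own a :=
  if needs_flip r a then tperm_mx (enum_rank (zero a)) (enum_rank (one a)) else 1%:M.

(** The outcomes are recovered from the memory by inverting [broadcast]. Any other memory gets the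
    identity, since unitarity is required for every memory. *)
Definition correct_op a (m : memory) : local_op C own a :=
  if [pick r : {ffun S -> 'I_nb_outcomes} | broadcast (values r) a == m] is Some r
  then correct (values r) a else 1%:M.

Lemma correct_op_unitary a m : correct_op a m \is unitarymx.
Proof.
have unit1 n : (1%:M : 'M[C]_n) \is unitarymx.
  by apply/unitarymxP; rewrite mul1mx trmx1 map_mx1.
rewrite /correct_op; case: pickP => [r _|_]; last exact: unit1.
by rewrite /correct; case: ifP => _; [apply: tperm_mx_unitary|apply: unit1].
Qed.

Lemma correct_op_broadcast (r : {ffun S -> 'I_nb_outcomes}) a :
  correct_op a (broadcast (values r) a) = correct (values r) a.
Proof.
rewrite /correct_op; case: pickP => [r' /eqP/broadcast_inj-> //|/(_ r)].
by rewrite eqxx.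
Qed.

Definition correction a : instr := Unitary (@correct_op_unitary a).

Definition corrected (r : S -> nat) f a : local_vec C own a :=
  correct r a *m compressed r f a.

Lemma run_corrections l (r : {ffun S -> 'I_nb_outcomes}) k v c :
  uniq l ->
  (forall f a, v f a = if a \in l then compressed (values r) f a else corrected (values r) f a) ->
  run [seq correction a | a <- l] (broadcast (values r), product_sum k v) c ->
  c.2 = product_sum k (corrected (values r)).
Proof.
elim: l v => [|a l IH] v /=.
  by move=> _ vE -> /=; apply: eq_product_sum.
case/andP=> al ul vE [d -> /=].
rewrite correct_op_broadcast.
pose w f b := if b \in l then compressed (values r) f b else corrected (values r) f b.
rewrite (@local_apply_product_sum _ _ _ _ _ _ _ _ _ w).
- exact: IH.
- by move=> f; rewrite vE /w inE eqxx (negPf al).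
- by move=> f b ba; rewrite vE /w inE (negPf ba).
Qed.

Lemma corrected_ket r f0 : [pick f | consistent r f] = Some f0 -> forall f a,
  corrected r f a = (sqrtC 2)^-1 *:
    ((view own a (lab f0) == view own a (lab f))%:R *: ket C (zero a)
     + (flip (view own a (lab f0)) == view own a (lab f))%:R *: ket C (one a)).
Proof.
move=> pick_f0 f a; rewrite /corrected /correct /needs_flip pick_f0 /compressed /encoded.
have /forallP/(_ a) : consistent r f0 by case: pickP pick_f0 => // g cg [<-].
rewrite compress_ket; case: eqP => [<- _|_ /= /eqP ->] /=; first by rewrite mul1mx.
(* Here the outcome is the complement of the string of [f0]: the two kets come out exchanged and the
   transposition swaps them back. *)
rewrite flipK -scalemxAr mulmxDr -!scalemxAr.
have -> : tperm_mx (enum_rank (zero a)) (enum_rank (one a)) *m ket C (zero a) = ket C (one a).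
  exact: tperm_mx_delta.
have -> : tperm_mx (enum_rank (zero a)) (enum_rank (one a)) *m ket C (one a) = ket C (zero a).
  by rewrite /tperm_mx tpermC; apply: tperm_mx_delta.
by rewrite addrC.
Qed.

(** * The output state, when local views fix a labelling up to complement *)

Variable neg : I -> I.
Hypothesis lab_neg : forall f, lab (neg f) = flip (lab f).
Hypothesis lab_rigid : forall f g,
  (forall a, view own a (lab g) = view own a (lab f)
          \/ view own a (lab g) = flip (view own a (lab f))) -> g = f \/ g = neg f.
Variable a0 : S.

Lemma flip_view a x : view own a (flip x) = flip (view own a x).
Proof. by apply/ffunP => q; rewrite !ffunE. Qed.

(** Only [f0] and [neg f0] contribute, giving all outputs 0 and all outputs 1. By rigidity any other
    labelling disagrees with both at some single agent, where its factor vanishes. *)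
Lemma corrected_sum r f0 k x : [pick f | consistent r f] = Some f0 ->
  product_sum k (corrected r) x = k * (sqrtC 2)^-1 ^+ #|S| *
    ([forall a, view own a x == zero a]%:R + [forall a, view own a x == one a]%:R).
Proof.
move=> pick_f0; rewrite ffunE -mulrA; congr (k * _).
(* Agent [a0] provides a qubit, on which the two labels differ. *)
have neg_neq : neg f0 != f0.
  apply/eqP => e; have /eqP := lab_neg f0; rewrite e eq_sym.
  by rewrite (flip_neq (out a0)).
have val_f f a : corrected r f a (enum_rank (view own a x)) 0 = (sqrtC 2)^-1 *
    ((view own a (lab f0) == view own a (lab f))%:R * (view own a x == zero a)%:R
     + (flip (view own a (lab f0)) == view own a (lab f))%:R
       * (view own a x == one a)%:R).
  rewrite (corrected_ket pick_f0) mxE; congr (_ * _).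
  by rewrite mxE; congr (_ + _); rewrite mxE ketE.
rewrite (bigD1 f0) //= (bigD1 (neg f0)) //= [X in _ + (_ + X)]big1 ?addr0 => [|f].
  rewrite mulrDr !ffunE -!prodr_natb -!prodr_const -!big_split /=.
  congr (_ + _); apply: eq_bigr => a _; rewrite val_f.
    by rewrite eqxx (flip_neq (out_held own_out a)) mul1r mul0r addr0.
  rewrite lab_neg flip_view eq_sym (flip_neq (out_held own_out a)) eqxx.
  by rewrite mul1r mul0r add0r.
case/andP=> f_f0 f_neg; rewrite ffunE.
have [a /negPf za /negPf oa] : exists2 a, view own a (lab f0) != view own a (lab f)
    & flip (view own a (lab f0)) != view own a (lab f).
  have : ~~ [forall a, (view own a (lab f) == view own a (lab f0))
      || (view own a (lab f) == flip (view own a (lab f0)))].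
    apply/negP => /forallP h; have [a|/eqP|/eqP] := @lab_rigid f0 f.
    - by case/orP: (h a) => /eqP; [left|right].
    - by rewrite (negPf f_f0).
    - by rewrite (negPf f_neg).
  rewrite negb_forall => /existsP[a]; rewrite negb_or => /andP[za oa].
  by exists a; rewrite eq_sym.
by rewrite (bigD1 a) //= val_f za oa !mul0r addr0 mulr0 mul0r.
Qed.

(** Regroups the qubits from one register per agent into outputs and rest, as [prepared_on]
    demands. *)
Lemma view_zeroE x : [forall a, view own a x == zero a]
  = ([ffun a => x (out a)] == [ffun=> ord0] :> bits S)
    && ([ffun q => x (val q)] == [ffun=> ord0] :> bits {q | q \notin codom out}).
Proof.
apply/forallP/andP => [h|[/eqP/ffunP ho /eqP/ffunP hr] a].
  have x0 q : x q = ord0.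
    have /eqP/ffunP/(_ (exist _ q (eqxx (own q)))) := h (own q).
    by rewrite !ffunE.
  by split; apply/eqP/ffunP => q; rewrite !ffunE x0.
apply/eqP/ffunP => -[q /= qa]; rewrite !ffunE /=.
have [/codomP[b ->]|q_out] := boolP (q \in codom out).
  by have := ho b; rewrite !ffunE.
by have := hr (exist _ q q_out); rewrite !ffunE.
Qed.

Lemma view_oneE x : [forall a, view own a x == one a]
  = ([ffun a => x (out a)] == [ffun=> ord_max] :> bits S)
    && ([ffun q => x (val q)] == [ffun=> ord0] :> bits {q | q \notin codom out}).
Proof.
apply/forallP/andP => [h|[/eqP/ffunP ho /eqP/ffunP hr] a].
  have x1 q : x q = if q == out (own q) then ord_max else ord0.
    have /eqP/ffunP/(_ (exist _ q (eqxx (own q)))) := h (own q).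
    by rewrite !ffunE.
  split; apply/eqP/ffunP => q; rewrite !ffunE x1; first by rewrite own_out eqxx.
  by case: eqP => // e; case/negP: (valP q); rewrite e codom_f.
apply/eqP/ffunP => -[q /= qa]; rewrite !ffunE /=; move/eqP: qa => qa.
have [/codomP[b qb]|q_out] := boolP (q \in codom out).
  by rewrite qb own_out in qa *; rewrite qa eqxx; have := ho a; rewrite !ffunE.
rewrite ifN; first by have := hr (exist _ q q_out); rewrite !ffunE.
by apply: contraNneq q_out => ->; apply: codom_f.
Qed.

Lemma corrected_prepared r k :
  product_sum k (corrected r) != 0 ->
  prepared_on out (ghz C S) (product_sum k (corrected r)).
Proof.
move=> chi0; have [x x0] := ffun_neq0 chi0.
(* Without a consistent labelling every term would vanish, but the state is nonzero. *)
have [f0 pick_f0] : exists f0, [pick f | consistent r f] = Some f0.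
  case: pickP => [f0 _|none]; first by exists f0.
  case/negP: x0; rewrite ffunE big1 ?mulr0 // => f _; rewrite ffunE.
  have /negbT := none f; rewrite negb_forall => /existsP[a].
  rewrite negb_or => /andP[/negPf zf /negPf of_].
  rewrite (bigD1 a) //= /corrected /compressed /encoded compress_ket.
  rewrite [read _ _ == _]eq_sym zf [flip _ == _]eq_sym of_ !scale0r addr0 scaler0 mulmx0.
  by rewrite mxE mul0r.
(* The other qubits are all reset to 0; the factor [sqrtC 2] compensates the normalization inside
   [ghz]. *)
exists [ffun y => k * (sqrtC 2)^-1 ^+ #|S| * sqrtC 2 * (y == [ffun=> ord0])%:R] => y.
rewrite (corrected_sum _ _ pick_f0) view_zeroE view_oneE !ffunE.
case: ([ffun q : {q | q \notin codom out} => y (val q)] == _); last by rewrite !andbF addr0 !mulr0.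
rewrite !andbT mulr1 [_ * sqrtC 2]mulrC [RHS]mulrACA mulVf ?mul1r 1?mulrC //.
by rewrite sqrtC_eq0 pnatr_eq0.
Qed.

Definition protocol : seq instr :=
  [seq measurement a | a <- enum S] ++ [seq send t | t <- enum message]
  ++ [seq correction a | a <- enum S].

Lemma run_cat (p p' : seq instr) c c' :
  run (p ++ p') c c' -> exists2 d, run p c d & run p' d c'.
Proof.
elim: p c => [|i p IH] c /=; first by exists c.
by case=> d cd /IH[e de ec]; exists e => //; exists d.
Qed.

Lemma run_protocol k c :
  product_sum k framed != 0 ->
  run protocol ([ffun=> [::]], product_sum k framed) c ->
  prepared_on out (ghz C S) c.2.
Proof.
move=> init0 run_c; have := run_neq0 (c := (_, _)) init0 run_c.
case/run_cat: run_c => d run_d /run_cat[e].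
have [||||k' [r [hr ->]]] := run_measurements (r := fun=> 0%N) _ _ _ _ run_d.
- exact: enum_uniq.
- by move=> a; rewrite mem_enum ffunE.
- by move=> a; rewrite mem_enum.
- by move=> f a; rewrite mem_enum.
move=> /run_sends -> /=.
have lt_r a : (r a < nb_outcomes)%N.
  exact: leq_trans (hr a) (leq_bigmax (F := fun a => #|{: bits (held own a)}|) a).
pose r' : {ffun S -> 'I_nb_outcomes} := [ffun a => Ordinal (lt_r a)].
have <- : values r' = r by apply/funext => a; rewrite ffunE.
move/(run_corrections (enum_uniq _)) => /(_ (fun f a => _)) ->; last first.
  by move=> f a; rewrite mem_enum.
exact: corrected_prepared.
Qed.

End Protocol.

(** * Sufficiency: labellings of a connected hypergraph *)

Section Sufficiency.
Variables (C : numClosedFieldType) (S : finType) (F : {set {set S}}).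
Variable anc : S -> nat.
Hypothesis no_anc : forall a, anc a = 0%N.
Local Notation Q := (qubit F anc).

Definition label (f : {ffun hedge F -> 'I_2}) : bits Q :=
  [ffun q => match q with inl e => f (tag e) | inr _ => ord0 end].

Definition negate (f : {ffun hedge F -> 'I_2}) : {ffun hedge F -> 'I_2} :=
  [ffun E => rev_ord (f E)].

Lemma ancilla_absurd (z : {a : S & 'I_(anc a)}) : False.
Proof. by case: z => a; rewrite no_anc; case. Qed.

(** The absence of ancillas matters: an ancilla would carry 0 in both labels. *)
Lemma label_negate f : label (negate f) = flip (label f).
Proof.
by apply/ffunP => -[e|z]; rewrite !ffunE //; case: (ancilla_absurd z).
Qed.

(** Whether [f] and [g] agree on a hyperedge is the same for all hyperedges at one agent, hence
    constant along hyperpaths, hence constant on [F]. *)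
Lemma label_rigid f g : hconnected F -> (forall E, E \in F -> E != set0) -> S ->
  (forall a, view (@holder S F anc) a (label g) = view _ a (label f)
          \/ view (@holder S F anc) a (label g) = flip (view _ a (label f))) ->
  g = f \/ g = negate f.
Proof.
move=> conn F0 a0 fg.
(* Defined on arbitrary sets, since hyperpaths are sequences of plain sets. *)
pose agree E := [exists h : hedge F, (val h == E) && (g h == f h)].
have agreeE (h : hedge F) : agree (val h) = (g h == f h).
  apply/existsP/idP => [[h' /andP[/eqP/val_inj-> //]]|gh].
  by exists h; rewrite eqxx.
have agree_meet (E E' : {set S}) a : E \in F -> E' \in F -> a \in E -> a \in E' ->
    agree E = agree E'.
  move=> EF E'F aE aE'.
  rewrite -[E]/(val (exist _ E EF : hedge F)) -[E']/(val (exist _ E' E'F : hedge F)).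
  rewrite !agreeE.
  pose q (h : hedge F) (ah : a \in val h) : Q := inl (existT (@member S F) h (exist _ a ah)).
  pose q' h ah : held (@holder S F anc) a := exist _ (@q h ah) (eqxx a).
  case: (fg a) => /ffunP e.
    have := e (q' (exist _ E EF) aE); have := e (q' (exist _ E' E'F) aE').
    by rewrite !ffunE /= => -> ->; rewrite !eqxx.
  have := e (q' (exist _ E EF) aE); have := e (q' (exist _ E' E'F) aE').
  by rewrite !ffunE /= => /eqP + /eqP; rewrite -!ord2_neq => /negPf-> /negPf->.
have agree_path E p : E \in F -> all (mem F) p -> path (@meets S) E p ->
    agree E = agree (last E p).
  elim: p E => //= E' p IH E EF /andP[E'F pF] /andP[/set0Pn[a]].
  by rewrite inE => /andP[aE aE'] /(IH _ E'F pF) <-; apply: agree_meet aE aE'.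
have agree_all E E' : E \in F -> E' \in F -> agree E = agree E'.
  move=> EF E'F; have /set0Pn[a aE] := F0 _ EF; have /set0Pn[b bE'] := F0 _ E'F.
  have [E1 [p /and4P[/= /andP[E1F pF] path_p aE1 bl]]] := conn a b.
  rewrite (agree_meet _ _ _ EF E1F aE aE1) (agree_path _ _ E1F pF path_p).
  apply: agree_meet bl bE' => //.
  by have := mem_last E1 p; rewrite inE => /predU1P[->|/(allP pF)].
have [E [p /and4P[/= /andP[EF _] _ _ _]]] := conn a0 a0.
have agreeF h : (g h == f h) = agree E by rewrite -agreeE; apply: agree_all (valP h) EF.
case: (agree E) agreeF => agreeF; [left|right]; apply/ffunP => h.
  exact/eqP/agreeF.
by rewrite ffunE; apply/eqP; rewrite -ord2_neq agreeF.
Qed.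

Variable phi : forall E : hedge F, state C (member E).
Variable U : forall E : hedge F, member E -> 'M[C]_2.
Hypothesis phiE : forall E, phi E = tensor_apply (@U E) (ghz C (member E)).

Definition qubit_frame (q : Q) : 'M[C]_2 :=
  match q with inl e => U (tagged e) | inr _ => 1%:M end.

(** Each shared state is a sum over one bit; expanding the product over the hyperedges gives a sum
    over labellings. *)
Lemma initial_stateE : initial_state anc phi
  = product_sum ((sqrtC 2)^-1 ^+ #|{: hedge F}|) (@framed C S Q (@holder S F anc) qubit_frame _ label).
Proof.
apply/ffunP => x; rewrite !ffunE [X in _ * X]big1 ?mulr1 => [|z _];
  last by case: (ancilla_absurd z).
under eq_bigr => E _ do rewrite phiE tensor_apply_ghz.
rewrite big_split /= prodr_const; congr (_ * _).
rewrite bigA_distr_bigA; apply: eq_bigr => f _.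
rewrite product_state_tensor big_sumType /= [X in _ * X]big1 ?mulr1 => [|z _];
  last by case: (ancilla_absurd z).
rewrite sig_big_dep /=; apply: eq_bigr => -[E a] _ /=.
by rewrite !ffunE.
Qed.

End Sufficiency.

Lemma connected_LOCC_preparable (C : numClosedFieldType) (S : finType)
    (F : {set {set S}}) (phi : forall E : hedge F, state C (member E)) :
  S -> (forall E, E \in F -> E != set0) -> (forall E, max_entangled (phi E)) ->
  hconnected F -> LOCC_preparable phi (ghz C S).
Proof.
move=> a0 F0 phi_max conn; pose anc (_ : S) := 0%N.
(* A hyperpath from [a] to itself yields a hyperedge at [a], whose qubit serves as the output. *)
have out_ex a : {q : qubit F anc | holder q = a}.
  apply: cid; have [E [p /and4P[/= /andP[EF _] _ aE _]]] := conn a a.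
  by exists (inl (existT (@member S F) (exist _ E EF) (exist _ a aE))).
pose out a := sval (out_ex a); have own_out a : holder (out a) = a := svalP (out_ex a).
have U E := cid2 (phi_max E).
have V_unitary q : qubit_frame (anc := anc) (fun E => s2val (U E)) q \is unitarymx.
  case: q => [e|z] /=; first exact: (s2valP (U (tag e))).
  by apply/unitarymxP; rewrite mul1mx trmx1 map_mx1.
have initE := initial_stateE (anc := anc) (fun=> erefl) (fun E => s2valP' (U E)).
exists anc, out, (protocol own_out (@label S F anc) V_unitary); split=> // c.
have init0 := initial_state_neq0 phi_max anc; rewrite initE in init0 *.
apply: (run_protocol (neg := @negate S F)) init0 => //.
- exact: label_negate.
- by move=> f g; apply: label_rigid.
Qed.

Theorem theorem4p1 (R : realType) (S : finType) (hS : (2 <= #|S|)%N)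
    (F : {set {set S}}) (hF : forall E : {set S}, E \in F -> (2 <= #|E|)%N)
    (phi : forall E : hedge F, state R[i] (member E))
    (hphi : forall E : hedge F, max_entangled (phi E)) :
  (exists2 psi : state R[i] S, max_entangled psi & LOCC_preparable phi psi)
  <-> hconnected F.
Proof.
split=> [[psi psi_max]|conn]; first exact: LOCC_preparable_connected.
exists (ghz R[i] S); first exact: ghz_max_entangled.
have /card_gt0P[a0 _] : (0 < #|S|)%N by apply: ltnW.
apply: connected_LOCC_preparable => // E /hF E2.
by rewrite -card_gt0 ltnW.
Qed.
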